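(* In the game BPFSI (binary probability forecasting with side information, described in the context), let $\pi$ be any prior density on $\mathbb{R}^d$ supporting a neighborhood of the origin, i.e. positive in a neighborhood of the origin. Then by the Bayesian logistic strategy with prior $\pi$ Skeptic can weakly force the conditional event $$E_1 \ \Rightarrow\ \limsup_{n\to\infty} \frac{\mathcal{S}_n'\,\mathcal{V}_n^{-1}\mathcal{S}_n}{\log\det\mathcal{V}_n}\le 1 .$$ That is, the capital process $\mathcal{K}_n^\pi$ is never negative, and $\limsup_n \mathcal{K}_n^\pi(\xi)=\infty$ for every path $\xi\in E_1$ for which $\limsup_n \mathcal{S}_n'\mathcal{V}_n^{-1}\mathcal{S}_n/\log\det\mathcal{V}_n>1$.
   Context: Game BPFSI. Fix $d\ge 1$. Put $\mathcal{K}_0=1$, $\mathcal{S}_0=0\in\mathbb{R}^d$, $\mathcal{V}_0=0\in\mathbb{R}^{d\times d}$. For $n=1,2,\dots$: Forecaster announces $p_n\in(0,1)$ and a column vector $c_n\in\mathbb{R}^d$; Skeptic announces $M_n\in\mathbb{R}$; Reality announces $x_n\in\{0,1\}$; then $\mathcal{K}_n=\mathcal{K}_{n-1}+M_n(x_n-p_n)$, $\mathcal{S}_n=\mathcal{S}_{n-1}+c_n(x_n-p_n)$, $\mathcal{V}_n=\mathcal{V}_{n-1}+c_nc_n'\,p_n(1-p_n)$, where $'$ denotes transpose. Skeptic must keep $\mathcal{K}_n$ non-negative. A path is an infinite sequence $\xi=p_1c_1x_1p_2c_2x_2\dots$ with $p_n\in(0,1)$, $c_n\in\mathbb{R}^d$,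 $x_n\in\{0,1\}$; an event is a set of paths. A strategy of Skeptic determines his move on day $n$ from $p_1c_1x_1\dots p_{n-1}c_{n-1}x_{n-1}p_nc_n$. Weak forcing: by a strategy with capital process $\mathcal{K}_n$, Skeptic can weakly force the conditional event $E_1\Rightarrow E_2$ if $\mathcal{K}_n$ is never negative and $\limsup_n\mathcal{K}_n(\xi)=\infty$ for all $\xi\in E_1\cap E_2^C$. Regularity event: with $\lambda_{\max,n},\lambda_{\min,n}$ the maximum and minimum eigenvalues of $\mathcal{V}_n$, $E_1$ is the set of paths such that $\lim_n\lambda_{\min,n}=\infty$, $\limsup_n\lambda_{\max,n}/\lambda_{\min,n}<\infty$, and $\{c_1,c_2,\dots\}$ is bounded. (On $E_1$, $\mathcal{V}_n$ is invertible and $\log\det\mathcal{V}_n>0$ for all large $n$.) Bayesian logistic strategy: for $\theta\in\mathbb{R}^d$ let $$\mathcal{K}_n^\theta=\frac{e^{\theta'\sum_{i=1}^n c_ix_i}}{\prod_{i=1}^n\bigl(1+p_i(e^{\theta'c_i}-1)\bigr)} .$$ This is the capital process of the strategy betting $M_n=\mathcal{K}_{n-1}\nu_n$, $\nu_n=\frac{\hat p_n-p_n}{p_n(1-p_n)}$, where $\log\frac{\hat p_n}{1-\hat p_n}=\log\frac{p_n}{1-p_n}+\theta'c_n$. For a prior probability density $\pi$ on $\mathbb{R}^d$, the Bayesian logistic strategy with prior $\pi$ is the strategy with capital process $\mathcal{K}_n^\pi=\int_{\mathbb{R}^d}\mathcal{K}_n^\theta\,\pi(\theta)\,d\theta$.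
   Formalization: The prior density is required to be bounded below by some positive constant on a neighborhood of the origin (automatic if it is continuous and positive at the origin); mere pointwise positivity of a measurable density makes the claim false. *)

(* Defs.v *)
From HB Require Import structures.
From mathcomp Require Import all_boot all_order all_algebra.
From mathcomp Require Import all_classical all_reals all_analysis.

Set Implicit Arguments.
Unset Strict Implicit.
Unset Printing Implicit Defensive.

Import Order.TTheory GRing.Theory Num.Theory.
Import numFieldNormedType.Exports.

Local Open Scope classical_set_scope.
Local Open Scope ring_scope.

(* Lebesgue measure on R^n, with R^n realised as the measurable type of
   n-tuples: the (n.+1)-fold product is the image of
   (n-fold product) \x lebesgue_measure under z |-> z.2 :: z.1.
   lebesgue_tuple_box below is the characterization by boxes. *)
Section lebesgue_tuple.
Variable R : realType.
Local Notation T := (measurableTypeR R).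

Definition tcons n (z : n.-tuple T * T) : n.+1.-tuple T :=
  [tuple of z.2 :: z.1].

Lemma measurable_tcons n : measurable_fun [set: _] (@tcons n).
Proof.
exact: (measurable_cons measurable_snd measurable_fst).
Qed.

Fixpoint lebesgue_tuple n : {measure set (n.-tuple T) -> \bar R} :=
  match n with
  | 0 => \d_[tuple]
  | m.+1 => measure_function_pushforward__canonical__measure_function_Measure
              (lebesgue_tuple m \x lebesgue_measure)%E (measurable_tcons (n:=m))
  end.

Lemma lebesgue_tuple_box n (A : 'I_n -> set T) :
  (forall i, measurable (A i)) ->
  lebesgue_tuple n [set t | forall i, A i (tnth t i)] =
  (\prod_(i < n) lebesgue_measure (A i))%E.
Proof.
elim: n A => [|n IHn] A mA /=.
  rewrite big_ord0 diracE mem_set//.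
  by case.
rewrite /pushforward.
have -> : @tcons n @^-1` [set t | forall i, A i (tnth t i)] =
  [set t | forall i : 'I_n, A (lift ord0 i) (tnth t i)] `*` A ord0.
  apply/seteqP; split=> -[t x] /=.
    move=> h; split; last by have := h ord0; rewrite tnth0.
    by move=> i; have := h (lift ord0 i); rewrite tnthS.
  move=> [ht hx] i; case: (unliftP ord0 i) => [j|] ->.
    by rewrite tnthS.
  by rewrite tnth0.
rewrite product_measure1E//.
  have := IHn (fun i => A (lift ord0 i)) (fun i => mA _).
  rewrite big_ord_recl muleC => <-.
  by [].
have -> : [set t : n.-tuple T | forall i : 'I_n, A (lift ord0 i) (tnth t i)] =
  \big[setI/setT]_(i < n) ((@tnth n T)^~ i @^-1` A (lift ord0 i)).
  apply/seteqP; split => t /=.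
    by move=> h; rewrite -bigcap_seq => i _; exact: h.
  by rewrite -bigcap_seq => h i; apply: h; rewrite /= mem_index_enum.
apply: bigsetI_measurable => i _; rewrite -[X in measurable X]setTI.
exact: measurable_tnth.
Qed.

End lebesgue_tuple.

Section game.
Variables (R : realType) (d : nat).

Definition dot (u v : 'cV[R]_d) : R := (u^T *m v) 0 0.

(* Days are numbered from 0: index n carries p_{n+1}, c_{n+1}, x_{n+1};
   true encodes the outcome 1. *)
Record game_path := GamePath {
  prob : nat -> R;
  side : nat -> 'cV[R]_d;
  outcome : nat -> bool;
  prob_itv : forall n, 0 < prob n < 1 }.

Definition event := set game_path.

Implicit Types xi : game_path.

Definition residual xi n : R := (outcome xi n)%:R - prob xi n.

Definition history xi n : seq (R * 'cV[R]_d * bool) :=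
  [seq (prob xi i, side xi i, outcome xi i) | i <- iota 0 n].

(* Skeptic's move, from the past rounds and the current announcement (p, c). *)
Definition strategy := seq (R * 'cV[R]_d * bool) -> R -> 'cV[R]_d -> R.

Fixpoint capital (sigma : strategy) xi n : R :=
  match n with
  | 0 => 1
  | m.+1 => capital sigma xi m +
            sigma (history xi m) (prob xi m) (side xi m) * residual xi m
  end.

Definition S_ xi n : 'cV[R]_d := \sum_(i < n) residual xi i *: side xi i.

Definition V_ xi n : 'M[R]_d :=
  \sum_(i < n) (prob xi i * (1 - prob xi i)) *: (side xi i *m (side xi i)^T).

Definition weakly_forces (sigma : strategy) (E1 E2 : event) : Prop :=
  (forall xi n, 0 <= capital sigma xi n) /\
  (forall xi, E1 xi -> ~ E2 xi ->
    limn_esup (fun n => (capital sigma xi n)%:E) = +oo%E).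

Definition lambda_max (A : 'M[R]_d) : R := sup [set a | eigenvalue A a].
Definition lambda_min (A : 'M[R]_d) : R := inf [set a | eigenvalue A a].

(* The totalized ratio is 0 while lambda_min (V_ xi n) = 0, which by the first
   clause concerns finitely many days and so does not affect the limsup. *)
Definition regularity_event : event :=
  [set xi | [/\ (fun n => lambda_min (V_ xi n)) @ \oo --> +oo,
    (limn_esup (fun n =>
       (lambda_max (V_ xi n) / lambda_min (V_ xi n))%:E) < +oo)%E &
    bounded_set (range (side xi))]].

(* On a regular path, V_ xi n is invertible and ln (\det (V_ xi n)) > 0 for
   all large n, so the totalized invmx, ln and division are harmless. *)
Definition lil_ratio xi n : R :=
  dot (S_ xi n) (invmx (V_ xi n) *m S_ xi n) / ln (\det (V_ xi n)).

Definition lil_bound : event :=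
  [set xi | (limn_esup (fun n => (lil_ratio xi n)%:E) <= 1)%E].

Definition logistic_capital (theta : 'cV[R]_d) xi n : R :=
  expR (dot theta (\sum_(i < n) (outcome xi i)%:R *: side xi i)) /
  \prod_(i < n) (1 + prob xi i * (expR (dot theta (side xi i)) - 1)).

Definition col_of_tuple (t : d.-tuple R) : 'cV[R]_d := \col_i tnth t i.

Definition integral_Rd (f : 'cV[R]_d -> R) : \bar R :=
  (\int[@lebesgue_tuple R d]_t (f (col_of_tuple t))%:E)%E.

Definition prior_density (pi : 'cV[R]_d -> R) : Prop :=
  [/\ measurable_fun [set: d.-tuple (measurableTypeR R)] (pi \o col_of_tuple),
      forall theta, 0 <= pi theta &
      integral_Rd pi = 1%E].

(* Positivity near the origin has to be locally uniform, as it is when pi is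
   continuous (or lower semicontinuous) at 0 with pi 0 > 0.  Pointwise
   positivity of a merely measurable density is not enough: for d = 1,
   c_n = 1, p_n = 1/2 and pi theta proportional to expR (- theta ^- 2) on
   [-1, 1] except pi 0 > 0, the mixture capital stays bounded along paths with
   S_n ^ 2 / (V_n * ln V_n) --> 2. *)
Definition supports_nbhs_origin (pi : 'cV[R]_d -> R) : Prop :=
  exists2 delta : R, 0 < delta &
    \forall theta \near (0 : 'cV[R]_d), delta <= pi theta.

Definition bayesian_capital (pi : 'cV[R]_d -> R) xi n : \bar R :=
  integral_Rd (fun theta => logistic_capital theta xi n * pi theta).

(* A capital process determines the bets, since x_n - p_n never vanishes; so
   this holds of at most one strategy, up to its values on sequences that are
   not histories of paths. *)
Definition bayesian_logistic (pi : 'cV[R]_d -> R) (sigma : strategy) : Prop :=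
  forall xi n, (capital sigma xi n)%:E = bayesian_capital pi xi n.

End game.

(* Main.v *)
From mathcomp Require Import all_boot all_order all_algebra.
From mathcomp Require Import sesquilinear spectral complex.
From mathcomp Require Import all_classical all_reals all_analysis.
From mathcomp Require Import measurable_realfun ring lra.
Require Import Defs.

Set Implicit Arguments.
Unset Strict Implicit.
Unset Printing Implicit Defensive.

Import Order.TTheory GRing.Theory Num.Theory.
Import numFieldNormedType.Exports.

Local Open Scope classical_set_scope.
Local Open Scope ring_scope.

(** The mixture is a martingale.  For a fixed theta, one round multiplies the
    logistic capital by a likelihood ratio whose mean under the announced
    probability is 1 ([likelihood_ratio_mean]).  Integrating against the prior
    preserves this ([bayesian_fair]), so betting the difference between the
    two possible values of the mixture reproduces the mixture
    ([bayesian_strategyP]); it is non-negative because its integrand is.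

    It is unbounded on the exceptional paths by Laplace's method.  The logarithm
    of the moment generating function of a Bernoulli variable is quadratic near
    the origin up to a factor 1 + e ([bernoulli_mgf_bound]), hence for small
    theta
      log K_n^theta >= theta' S_n - (1 + e) / 2 theta' V_n theta
    ([logistic_capital_ge]).  Suppose that Q = S' V^-1 S exceeds
    A = (1 + eta) log det V.  At theta0 = t V^-1 S with t = sqrt (A / Q) <= 1,
    the right-hand side is t Q - (1 + e) / 2 A >= (1 - e) / 2 A.  The
    normalization theta0' V theta0 = A, instead of the maximizer of the
    quadratic form, keeps theta0 small however large Q is: on a regular path
    |theta0|^2 <= A / lambda_min tends to 0.

    Moving theta0 by phi with |phi| = O(lambda_max^(-1/2)) costs a constant in
    the quadratic term, and the linear term in phi is non-negative on the
    orthant that has the right signs.  So the lower bound holds, up to a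
    constant factor, on a box of side of order lambda_max^(-1/2), with one
    corner at theta0, on which the prior density is at least delta
    ([bayesian_capital_ge]).  As lambda_max <= kappa lambda_min and
    lambda_min^d <= det V, the volume of the box is at least a constant times
    (det V)^(-1/2), and with (1 - e) (1 + eta) = 1 + eta / 2 the capital is at
    least a constant times
      (det V)^((1 + eta / 2) / 2) (det V)^(-1/2) = (det V)^(eta / 4),
    which tends to infinity ([mixture_growth]).

    The extreme eigenvalues are tied to the quadratic form and to the
    determinant by the spectral theorem ([symmetric_spectrum]). *)

(** * Spectrum of real symmetric matrices *)

Section real_spectral_theorem.
Local Open Scope sesquilinear_scope.

(** The spectral theorem in scalar form.  It comes from the unitary
    diagonalization A = P^* D P over the complex numbers, where the eigenvalues
    are real and w i is the squared modulus of entry i of P v; this spares the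
    choice of a real orthonormal basis. *)
Lemma symmetric_spectrum (R : rcfType) n (A : 'M[R]_n) : A^T = A ->
  exists D : 'I_n -> R, [/\ forall i, eigenvalue A (D i), \det A = \prod_i D i &
    forall v : 'cV[R]_n, exists w : 'I_n -> R, [/\ forall i, 0 <= w i,
      (v^T *m v) 0 0 = \sum_i w i &
      (v^T *m (A *m v)) 0 0 = \sum_i D i * w i]].
Proof.
move=> symA; pose toC := real_complex R; pose AC := map_mx toC A.
have AC_herm : AC \is hermsymmx.
  apply: realsym_hermsym.
    apply/is_hermitianmxP; rewrite expr0 scale1r.
    by apply/matrixP => i j; rewrite !mxE -{1}symA mxE.
  by apply/mxOverP => i j; rewrite mxE complex_real.
have /hermitian_normalmx/orthomx_spectralP AE := AC_herm.
set P := spectralmx AC in AE; set D := spectral_diag AC in AE.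
have P_unit : P \in unitmx by exact: spectral_unit.
have PE : invmx P = P^t* by apply/invmx_unitary/spectral_unitarymx.
pose d i := complex.Re (D 0 i).
have dE i : toC (d i) = D 0 i.
  by apply: RRe_real; exact: (mxOverP (hermitian_spectral_diag_real AC_herm)).
exists d; split=> [i||v].
- rewrite eigenvalue_root_char -(fmorph_root (real_complex R)) map_char_poly.
  rewrite -eigenvalue_root_char; apply/eigenvalueP; exists (row i P).
    rewrite -row_mul [X in _ *m X]AE !mulmxA mulmxV// mul1mx row_mul.
    by rewrite [_ (d i)]dE row_diag_mx -scalemxAl -rowE.
  apply/eqP => Pi0; have := oner_neq0 R[i].
  have : (row i P *m invmx P) 0 i = 1 by rewrite -row_mul mulmxV// !mxE eqxx.
  by rewrite Pi0 mul0mx mxE => <-; rewrite eqxx.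
- apply: (@complexI R); rewrite -[LHS](det_map_mx toC) -/AC AE.
  rewrite !det_mulmx mulrAC.
  rewrite -det_mulmx mulVmx// det1 mul1r det_diag.
  by rewrite [RHS](rmorph_prod toC); apply: eq_bigr => i _; rewrite -dE.
(* The coordinates of v in the eigenbasis. *)
pose u := P *m map_mx toC v.
have uct : u^t* = (map_mx toC v)^T *m invmx P.
  rewrite PE /u trmx_mul map_mxM; congr (_ *m _).
  apply/matrixP => i j; rewrite !mxE.
  by apply/CrealP; rewrite complex_real.
pose w i := complex.Re (`|u i 0| ^+ 2).
have wE i : toC (w i) = u i 0 * (u i 0)^*.
  by rewrite -normCK; apply: RRe_real; rewrite ger0_real// exprn_ge0.
exists w; split.
- by move=> i; rewrite -(ler0c (w i)) [X in _ <= X]wE mul_conjC_ge0.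
- apply: (@complexI R); rewrite [RHS](rmorph_sum toC).
  have e : toC ((v^T *m v) 0 0) = (u^t* *m u) 0 0.
    rewrite uct /u mulmxA mulmxKV// map_trmx -map_mxM.
    by rewrite [RHS]mxE.
  rewrite [LHS]e mxE; apply: eq_bigr => i _; rewrite [RHS]wE mulrC.
  by congr (_ * _); rewrite !mxE.
- apply: (@complexI R); rewrite [RHS](rmorph_sum toC).
  have e : toC ((v^T *m (A *m v)) 0 0) = (u^t* *m (diag_mx D *m u)) 0 0.
    have -> : u^t* *m (diag_mx D *m u) =
        (map_mx toC v)^T *m (AC *m map_mx toC v).
      by rewrite uct /u [in RHS]AE !mulmxA.
    by rewrite map_trmx -!map_mxM [RHS]mxE.
  rewrite [LHS]e mxE; apply: eq_bigr => i _.
  have -> : u^t* 0 i = (u i 0)^* by rewrite !mxE.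
  have -> : (diag_mx D *m u) i 0 = D 0 i * u i 0 by rewrite mul_diag_mx mxE.
  rewrite [RHS](rmorphM toC) [X in _ = _ * X]wE [X in _ = X * _]dE.
  by rewrite mulrCA [_^* * _]mulrC.
Qed.

End real_spectral_theorem.

Section spectrum_bounds.
Variables (R : realType) (n : nat).
Implicit Types (A : 'M[R]_n) (v : 'cV[R]_n).

Lemma dot_ge0 v : 0 <= dot v v.
Proof. by rewrite /dot mxE sumr_ge0// => i _; rewrite mxE -expr2 sqr_ge0. Qed.

Lemma dot_eq0 v : (dot v v == 0) = (v == 0).
Proof.
rewrite /dot mxE psumr_eq0; last by move=> i _; rewrite mxE -expr2 sqr_ge0.
apply/allP/eqP => [h|-> i _]; last by rewrite !mxE mulr0 eqxx.
apply/matrixP => i j; rewrite ord1 mxE; have := h i (mem_index_enum _).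
by rewrite /= mxE -expr2 sqrf_eq0 => /eqP.
Qed.

Lemma symmetric_eigenvector A a : A^T = A -> eigenvalue A a ->
  exists2 v : 'cV[R]_n, v != 0 & A *m v = a *: v.
Proof.
move=> symA /eigenvalueP[u uA u0]; exists u^T; first by rewrite trmx_eq0 //.
by rewrite -{1}symA -trmx_mul uA linearZ.
Qed.

(** The infimum and supremum of the spectrum are only meaningful once the
    spectrum is known to be bounded, here by the sum of the |D i|. *)
Lemma eigenvalue_bounds A a : A^T = A -> eigenvalue A a ->
  lambda_min A <= a <= lambda_max A.
Proof.
move=> symA Aa; have [D [_ _ rayleigh]] := symmetric_spectrum symA.
have bound b : eigenvalue A b -> `|b| <= \sum_i `|D i|.
  move=> /(symmetric_eigenvector symA)[v v0 Av].
  have [w [w0 vv vAv]] := rayleigh v.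
  have v_gt0 : 0 < \sum_i w i by rewrite -vv lt_def dot_eq0 v0 dot_ge0.
  have : b * \sum_i w i = \sum_i D i * w i.
    by rewrite -vAv -vv Av -scalemxAr [RHS]mxE.
  rewrite -(ler_pM2r v_gt0) -[X in _ * X <= _]gtr0_norm// -normrM => ->.
  rewrite mulr_sumr (le_trans (ler_norm_sum _ _ _))// ler_sum// => i _.
  rewrite normrM (ger0_norm (w0 i)) ler_wpM2r// (bigD1 i)//= lerDl.
  by rewrite sumr_ge0// => j _; exact: normr_ge0.
apply/andP; split.
  apply: ge_inf => //; exists (- \sum_i `|D i|) => b /bound.
  by rewrite ler_norml => /andP[].
apply: ub_le_sup => //; exists (\sum_i `|D i|) => b /bound.
by rewrite ler_norml => /andP[].
Qed.

Lemma lambda_min_le_max A : (0 < n)%N -> A^T = A ->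
  lambda_min A <= lambda_max A.
Proof.
move=> n0 symA; have [D [DA _ _]] := symmetric_spectrum symA.
by have /andP[] := eigenvalue_bounds symA (DA (Ordinal n0)); exact: le_trans.
Qed.

Lemma rayleigh_bounds A v : A^T = A ->
  lambda_min A * dot v v <= dot v (A *m v) <= lambda_max A * dot v v.
Proof.
move=> symA; have [D [DA _ rayleigh]] := symmetric_spectrum symA.
have [w [w0 vv vAv]] := rayleigh v; rewrite /dot vv vAv !mulr_sumr.
by apply/andP; split; apply: ler_sum => i _; apply: ler_wpM2r => //;
  have /andP[] := eigenvalue_bounds symA (DA i).
Qed.

Lemma det_bounds A : A^T = A -> 0 <= lambda_min A ->
  lambda_min A ^+ n <= \det A <= lambda_max A ^+ n.
Proof.
move=> symA A0; have [D [DA -> _]] := symmetric_spectrum symA.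
have DB i := andP (eigenvalue_bounds symA (DA i)).
have cE (c : R) : c ^+ n = \prod_(i < n) c by rewrite prodr_const card_ord.
rewrite !cE.
apply/andP; split; apply: ler_prod => i _; have [? ?] := DB i.
  by rewrite A0.
by rewrite (le_trans A0)//=.
Qed.

End spectrum_bounds.

(** * Moment generating function of a Bernoulli variable *)

Section cumulant.
Variable R : realType.
Implicit Types e p s : R.

Lemma mgf_gt0 p s : 0 < p < 1 -> 0 < 1 + p * (expR s - 1).
Proof. by move=> /andP[p0 p1]; have := expR_gt0 s; nra. Qed.

(** From exp (- s) >= 1 - s one gets exp s - 1 <= s / (1 - s), and the range of
    s is the one on which 1 / (1 - s) <= 1 + e. *)
Lemma expRB1_le e s : 0 < e -> 0 <= s -> s <= e / (1 + e) ->
  expR s - 1 <= (1 + e) * s.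
Proof.
move=> e0 s0 se.
have {}se : s * (1 + e) <= e by rewrite -ler_pdivlMr //; lra.
have h1 : (1 - s) * expR s <= 1.
  rewrite -[X in _ <= X](expRxMexpNx_1 s) [X in X <= _]mulrC.
  by apply: ler_wpM2l; [exact: expR_ge0 | exact: expR_ge1Dx].
have s1 : 0 < (1 - s) * (1 + e) by lra.
have := expR_ge1Dx s.
nra.
Qed.

(** The difference of the logarithms of the two sides vanishes at 0, and its
    derivative has the sign of
    (1 + e) s (1 + p (exp s - 1)) - (exp s - 1), which [expRB1_le] controls. *)
Lemma bernoulli_mgf_bound_nneg e p s : 0 < e -> 0 < p < 1 ->
  0 <= s -> s <= e / (1 + e) ->
  1 + p * (expR s - 1) <= expR (p * s + (1 + e) / 2 * (p * (1 - p)) * s ^+ 2).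
Proof.
move=> e0 p01 s0 se.
pose g (x : R) : R := p * x + (1 + e) / 2 * (p * (1 - p)) * x ^+ 2 -
  ln (1 + p * (expR x - 1)).
pose dg (x : R) : R := p + (1 + e) * (p * (1 - p)) * x -
  p * expR x / (1 + p * (expR x - 1)).
have dgP (x : R) : is_derive x 1 g (dg x).
  have := mgf_gt0 x p01 => m0.
  have c1 : is_derive x 1 (cst (1 : R)) 0 by exact: is_derive_cst.
  have i1 : is_derive x 1 (@id R) 1 by exact: is_derive_id.
  have d1 := is_deriveD c1 (is_deriveZ p (is_deriveB (is_derive_expR x) c1)).
  have l1 : is_derive ((cst 1 + p \*: (@expR R - cst 1)) x) 1 (@ln R)
    (1 + p * (expR x - 1))^-1 by exact: is_derive1_ln.
  have d2 := is_derive1_comp l1 d1.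
  have d3 := is_deriveB (is_deriveD (is_deriveZ p i1)
    (is_deriveZ ((1 + e) / 2 * (p * (1 - p))) (is_deriveM i1 i1))) d2.
  apply: (is_derive_eq d3).
  have m1 : 1 + p * (expR x - 1) != 0 by rewrite gt_eqF.
  by rewrite /dg /GRing.scale /=; field.
have : g 0 <= g s.
  have [|c /itvP cs gE] := MVT_segment s0 (fun x _ => dgP x).
    apply: continuous_subspaceT => x; apply: differentiable_continuous.
    by apply/derivable1_diffP; have [] := dgP x.
  rewrite -subr_ge0 gE subr0 mulr_ge0//.
  have m0 := mgf_gt0 c p01.
  have c0 : 0 <= c by rewrite cs.
  have := expRB1_le e0 c0 (le_trans _ se); rewrite cs => /(_ isT) ec.
  have -> : dg c = p * (1 - p) * ((1 + e) * c * (1 + p * (expR c - 1)) -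
      (expR c - 1)) / (1 + p * (expR c - 1)).
    by rewrite /dg; field; rewrite gt_eqF.
  have ec0 : 0 <= expR c - 1 by have := expR_ge1Dx c; lra.
  apply: divr_ge0; last exact: ltW.
  case/andP: p01 => p0 p1; apply: mulr_ge0; first by nra.
  have : 0 <= (1 + e) * c * (p * (expR c - 1)) by rewrite !mulr_ge0; lra.
  lra.
rewrite /g mulr0 expR0 subrr mulr0 addr0 ln1 expr0n mulr0 subr0 addr0 subr_ge0.
by rewrite -ler_expR lnK// posrE mgf_gt0.
Qed.

(** The factor p (1 - p), rather than p alone, is what makes the quadratic term
    add up to V_n.  Negative s reduce to positive ones by exchanging the two
    outcomes, (p, s) |-> (1 - p, - s). *)
Lemma bernoulli_mgf_bound e p s : 0 < e -> 0 < p < 1 -> `|s| <= e / (1 + e) ->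
  1 + p * (expR s - 1) <= expR (p * s + (1 + e) / 2 * (p * (1 - p)) * s ^+ 2).
Proof.
move=> e0 p01 se; have [s0|s0] := leP 0 s.
  by apply: bernoulli_mgf_bound_nneg => //; rewrite -(ger0_norm s0).
have q01 : 0 < 1 - p < 1 by lra.
have := @bernoulli_mgf_bound_nneg e (1 - p) (- s) e0 q01.
rewrite -(ltr0_norm s0) => /(_ (normr_ge0 _) se); rewrite ltr0_norm//.
rewrite -(ler_pM2r (expR_gt0 s)) -expRD; congr (_ <= _).
  transitivity (p * expR s + (1 - p) * (expR s * expR (- s))); first by ring.
  by rewrite expRxMexpNx_1; ring.
by congr (expR _); ring.
Qed.
End cumulant.

(** * Logistic capital near the origin *)

Section dot_product.
Variables (R : realType) (d : nat).
Implicit Types u v w : 'cV[R]_d.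

Lemma dotC u v : dot u v = dot v u.
Proof. by rewrite /dot !mxE; apply: eq_bigr => i _; rewrite !mxE mulrC. Qed.

Lemma dotDr u v w : dot u (v + w) = dot u v + dot u w.
Proof. by rewrite /dot mulmxDr mxE. Qed.

Lemma dotZr a u v : dot u (a *: v) = a * dot u v.
Proof. by rewrite /dot -scalemxAr mxE. Qed.

Lemma dotDl u v w : dot (v + w) u = dot v u + dot w u.
Proof. by rewrite dotC dotDr dotC (dotC u w). Qed.

Lemma dotZl a u v : dot (a *: u) v = a * dot u v.
Proof. by rewrite dotC dotZr dotC. Qed.

Lemma dot0r u : dot u 0 = 0.
Proof. by rewrite /dot mulmx0 mxE. Qed.

Lemma dotE u v : dot u v = \sum_i u i 0 * v i 0.
Proof. by rewrite /dot mxE; apply: eq_bigr => i _; rewrite mxE. Qed.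

Lemma dot_mulmx_sym (A : 'M[R]_d) u v :
  A^T = A -> dot u (A *m v) = dot v (A *m u).
Proof.
by move=> symA; rewrite dotC /dot trmx_mul symA mulmxA.
Qed.

Lemma sqr_entry_le_dot v i : v i 0 ^+ 2 <= dot v v.
Proof.
rewrite dotE (bigD1 i)//= -expr2 lerDl sumr_ge0// => j _.
by rewrite -expr2 sqr_ge0.
Qed.

Lemma norm_dot_le u v (a b : R) : 0 <= a ->
  (forall i, `|u i 0| <= a) -> (forall i, `|v i 0| <= b) ->
  `|dot u v| <= d%:R * (a * b).
Proof.
move=> a0 ua vb; rewrite dotE (le_trans (ler_norm_sum _ _ _))//.
have -> : d%:R * (a * b) = \sum_(i < d) a * b.
  by rewrite sumr_const card_ord mulr_natl.
by apply: ler_sum => i _; rewrite normrM ler_pM.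
Qed.

(** The linear term is a multiple of dot phi S because V theta0 is one of S. *)
Lemma quadratic_exponent_shift (S theta0 phi : 'cV[R]_d) (V : 'M[R]_d)
    (t b A : R) :
  V^T = V -> V *m theta0 = t *: S -> dot theta0 (V *m theta0) = A ->
  dot (theta0 + phi) S -
    b / 2 * dot (theta0 + phi) (V *m (theta0 + phi)) =
  dot theta0 S - b / 2 * A + (1 - b * t) * dot phi S -
    b / 2 * dot phi (V *m phi).
Proof.
move=> symV Vtheta0 <-; rewrite mulmxDr !(dotDl, dotDr).
rewrite (dot_mulmx_sym theta0 phi symV).
have -> : dot phi (V *m theta0) = t * dot phi S by rewrite Vtheta0 dotZr.
by field.
Qed.

End dot_product.

Section logistic.
Variables (R : realType) (d : nat).
Implicit Types (xi : game_path R d) (theta : 'cV[R]_d).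

Lemma logistic_capital0 theta xi : logistic_capital theta xi 0 = 1.
Proof. by rewrite /logistic_capital !big_ord0 dot0r expR0 divr1. Qed.

Lemma logistic_capitalS theta xi n : logistic_capital theta xi n.+1 =
  logistic_capital theta xi n *
  (expR ((outcome xi n)%:R * dot theta (side xi n)) /
   (1 + prob xi n * (expR (dot theta (side xi n)) - 1))).
Proof.
rewrite /logistic_capital !big_ord_recr /= dotDr dotZr expRD invfM.
by rewrite mulrACA.
Qed.

Lemma logistic_capital_gt0 theta xi n : 0 < logistic_capital theta xi n.
Proof.
elim: n => [|n IHn]; first by rewrite logistic_capital0.
rewrite logistic_capitalS mulr_gt0// divr_gt0 ?expR_gt0//.
exact/mgf_gt0/prob_itv.
Qed.

Lemma V_sym xi n : (V_ xi n)^T = V_ xi n.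
Proof.
rewrite /V_ linear_sum; apply: eq_bigr => i _.
by rewrite linearZ/= trmx_mul trmxK.
Qed.

(** The bounds of [bernoulli_mgf_bound] for the successive rounds add up to the
    quadratic form of V_n, and the linear terms to that of S_n. *)
Lemma logistic_capital_ge e theta xi n : 0 < e ->
  (forall i, `|dot theta (side xi i)| <= e / (1 + e)) ->
  expR (dot theta (S_ xi n) - (1 + e) / 2 * dot theta (V_ xi n *m theta)) <=
  logistic_capital theta xi n.
Proof.
move=> e0 small; elim: n => [|n IHn].
  rewrite logistic_capital0 /S_ /V_ !big_ord0 mul0mx !dot0r.
  by rewrite mulr0 subrr expR0.
set s := dot theta (side xi n); set p := prob xi n.
have -> : dot theta (S_ xi n.+1) = dot theta (S_ xi n) + residual xi n * s.
  by rewrite /S_ big_ord_recr /= dotDr dotZr.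
have -> : dot theta (V_ xi n.+1 *m theta) =
    dot theta (V_ xi n *m theta) + p * (1 - p) * s ^+ 2.
  rewrite /V_ big_ord_recr /= mulmxDl dotDr -scalemxAl dotZr; congr (_ + _ * _).
  rewrite -mulmxA [_^T *m theta]mx11_scalar mul_mx_scalar dotZr.
  by rewrite -/(dot (side xi n) theta) [dot (side xi n) _]dotC.
rewrite logistic_capitalS -/s -/p.
have -> : dot theta (S_ xi n) + residual xi n * s - (1 + e) / 2 *
    (dot theta (V_ xi n *m theta) + p * (1 - p) * s ^+ 2) =
    (dot theta (S_ xi n) - (1 + e) / 2 * dot theta (V_ xi n *m theta)) +
    ((outcome xi n)%:R * s - (p * s + (1 + e) / 2 * (p * (1 - p)) * s ^+ 2)).
  by rewrite /residual -/p; ring.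
rewrite expRD ler_pM ?expR_ge0// expRB ler_wpM2l ?expR_ge0//.
have p01 := prob_itv xi n.
rewrite lef_pV2 ?posrE ?expR_gt0 ?mgf_gt0//.
by apply: bernoulli_mgf_bound => //; exact: small.
Qed.
End logistic.

(** * Integration over boxes *)

Section lebesgue_Rd.
Variables (R : realType) (d : nat).
Local Notation T := (measurableTypeR R).
Local Notation measurable_Rd f :=
  (measurable_fun [set: d.-tuple T] (f \o @col_of_tuple R d)).

Lemma measurable_dot (c : 'cV[R]_d) : measurable_Rd (fun theta => dot theta c).
Proof.
rewrite (_ : _ \o _ = fun t : d.-tuple T => \sum_i tnth t i * c i 0).
  apply: measurable_sum => i; apply: measurable_funM => //.
  exact: measurable_tnth.
by apply/funext => t /=; rewrite dotE; apply: eq_bigr => i _; rewrite mxE.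
Qed.

(** A product box suffices for Laplace's method here, so no change of variables
    in the Lebesgue measure is involved. *)
Lemma integral_Rd_ge_box (f : 'cV[R]_d -> R) (a : 'I_d -> R) (r m : R) :
  measurable_Rd f -> (forall theta, 0 <= f theta) -> 0 <= r -> 0 <= m ->
  (forall theta : 'cV[R]_d, (forall i, a i <= theta i 0 <= a i + r) ->
    m <= f theta) ->
  ((m * r ^+ d)%:E <= integral_Rd f)%E.
Proof.
move=> mf f0 r0 m0 fbox.
pose I i : set T := [set` `[a i, a i + r]].
pose B := [set t : d.-tuple T | forall i, I i (tnth t i)].
have mI i : measurable (I i) by exact: measurable_itv.
have mB : measurable B.
  have -> : B = \big[setI/setT]_(i < d) ((@tnth d T)^~ i @^-1` I i).
    apply/seteqP; split => t /=.
      by move=> h; rewrite -bigcap_seq => i _; exact: h.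
    by rewrite -bigcap_seq => h i; apply: h; rewrite /= mem_index_enum.
  apply: bigsetI_measurable => i _; rewrite -[X in measurable X]setTI.
  exact: measurable_tnth.
have -> : (m * r ^+ d)%:E = (\int[@lebesgue_tuple R d]_(t in B) cst m%:E t)%E.
  rewrite integral_cst// (lebesgue_tuple_box mI).
  have -> : r ^+ d = \prod_(i < d) r by rewrite prodr_const card_ord.
  rewrite EFinM -prodEFin; congr (_ * _)%E.
  apply: eq_bigr => i _; rewrite lebesgue_measure_itv/= lte_fin.
  have [r1|] := ltrP (a i) (a i + r).
    by rewrite -EFinB addrAC subrr add0r.
  by rewrite gerDl => r1; congr EFin; apply/eqP; rewrite eq_le r0 r1.
have mfE : measurable_fun [set: d.-tuple T] (EFin \o (f \o @col_of_tuple R d)).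
  exact/measurable_EFinP.
apply: (@le_trans _ _
  (\int[@lebesgue_tuple R d]_(t in B) (f (col_of_tuple t))%:E)%E).
  apply: ge0_le_integral => //.
  - exact: measurable_funTS.
  - move=> t Bt; rewrite lee_fin; apply: fbox => i; rewrite mxE.
    by have := Bt i; rewrite /I /= in_itv.
apply: ge0_subset_integral => // t _; rewrite lee_fin; exact: f0.
Qed.

End lebesgue_Rd.

(** * The mixture as a capital process *)

Section bayesian_martingale.
Variables (R : realType) (d : nat) (pi : 'cV[R]_d -> R).
Hypothesis pi_prior : prior_density pi.
Local Notation T := (measurableTypeR R).
Local Notation measurable_Rd f :=
  (measurable_fun [set: d.-tuple T] (f \o @col_of_tuple R d)).
Implicit Types (z : R * 'cV[R]_d * bool) (h : seq (R * 'cV[R]_d * bool)).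
Implicit Types (theta c : 'cV[R]_d) (p : R) (xi : game_path R d).

Definition likelihood_ratio z theta : R :=
  expR (z.2%:R * dot theta z.1.2) / (1 + z.1.1 * (expR (dot theta z.1.2) - 1)).

(** The integrand of the mixture, as a function of the history: this is the form
    in which a strategy can see it. *)
Definition weighted_likelihood h theta : R :=
  \prod_(z <- h) likelihood_ratio z theta * pi theta.

Lemma weighted_likelihood_rcons h z theta :
  weighted_likelihood (rcons h z) theta =
  likelihood_ratio z theta * weighted_likelihood h theta.
Proof.
by rewrite /weighted_likelihood -cats1 big_cat big_seq1 /= mulrAC mulrC.
Qed.

Lemma historyS xi n : history xi n.+1 =
  rcons (history xi n) (prob xi n, side xi n, outcome xi n).
Proof. by rewrite /history -[in iota _ _]addn1 iotaD map_cat add0n cats1. Qed.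

Lemma weighted_likelihood_history xi n theta :
  weighted_likelihood (history xi n) theta =
  logistic_capital theta xi n * pi theta.
Proof.
elim: n => [|n IHn].
  by rewrite logistic_capital0 /weighted_likelihood /history big_nil.
rewrite historyS weighted_likelihood_rcons IHn logistic_capitalS.
by rewrite mulrCA mulrA.
Qed.

Lemma likelihood_ratio_ge0 z theta :
  0 < z.1.1 < 1 -> 0 <= likelihood_ratio z theta.
Proof. by move=> p01; rewrite divr_ge0 ?expR_ge0// ltW// mgf_gt0. Qed.

Lemma measurable_likelihood_ratio z :
  0 < z.1.1 < 1 -> measurable_Rd (likelihood_ratio z).
Proof.
move=> p01.
pose q (s : R) := expR (z.2%:R * s) / (1 + z.1.1 * (expR s - 1)).
apply: (@measurableT_comp _ _ _ _ _ _ q _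
  (fun t => dot (col_of_tuple t) z.1.2)); last exact: measurable_dot.
apply: continuous_measurable_fun => s; apply: cvgM.
  apply: continuous_comp; last exact: continuous_expR.
  exact: mulrl_continuous.
apply: cvgV; first by rewrite gt_eqF// mgf_gt0.
apply: cvgD; first exact: cvg_cst.
apply: cvgM; first exact: cvg_cst.
apply: cvgB; [exact: continuous_expR | exact: cvg_cst].
Qed.

Lemma weighted_likelihood_ge0 xi n theta :
  0 <= weighted_likelihood (history xi n) theta.
Proof.
case: pi_prior => _ pi0 _.
by rewrite weighted_likelihood_history mulr_ge0// ltW// logistic_capital_gt0.
Qed.

Lemma measurable_weighted_likelihood xi n :
  measurable_Rd (weighted_likelihood (history xi n)).
Proof.
elim: n => [|n IHn].
  case: pi_prior => mpi _ _; rewrite (_ : weighted_likelihood _ = pi)//.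
  by apply/funext => theta; rewrite /weighted_likelihood big_nil mul1r.
rewrite historyS (_ : _ \o _ =
    (likelihood_ratio (prob xi n, side xi n, outcome xi n) \o @col_of_tuple R d)
    \* (weighted_likelihood (history xi n) \o @col_of_tuple R d)).
  apply: measurable_funM => //.
  by apply: measurable_likelihood_ratio; exact: prob_itv.
by apply/funext => t /=; rewrite weighted_likelihood_rcons.
Qed.

Lemma likelihood_ratio_mean p c theta : 0 < p < 1 ->
  p * likelihood_ratio (p, c, true) theta +
  (1 - p) * likelihood_ratio (p, c, false) theta = 1.
Proof.
move=> p01; rewrite /likelihood_ratio /= mul1r mul0r expR0.
by field; rewrite gt_eqF// mgf_gt0.
Qed.

(** The mixture capital is a martingale.  It is stated with extended reals, and
    so also propagates finiteness: both probabilities being positive, the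
    two integrals after the round are finite when the one before it is. *)
Lemma bayesian_fair xi n :
  let p := prob xi n in let z b := (p, side xi n, b) in
  let I b := integral_Rd (weighted_likelihood (rcons (history xi n) (z b))) in
  (p%:E * I true + (1 - p)%:E * I false)%E =
  integral_Rd (weighted_likelihood (history xi n)).
Proof.
move=> p z I; have p01 := prob_itv xi n.
have w0 b theta : 0 <= weighted_likelihood (rcons (history xi n) (z b)) theta.
  rewrite weighted_likelihood_rcons mulr_ge0 ?weighted_likelihood_ge0//.
  exact: (@likelihood_ratio_ge0 (z b) theta p01).
have mw b : measurable_Rd (weighted_likelihood (rcons (history xi n) (z b))).
  rewrite (_ : _ \o _ = (likelihood_ratio (z b) \o @col_of_tuple R d)
    \* (weighted_likelihood (history xi n) \o @col_of_tuple R d)).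
    apply: measurable_funM; last exact: measurable_weighted_likelihood.
    exact: (@measurable_likelihood_ratio (z b) p01).
  by apply/funext => t /=; rewrite weighted_likelihood_rcons.
have mwE b : measurable_fun [set: d.-tuple T]
    (fun t => (weighted_likelihood (rcons (history xi n) (z b))
      (col_of_tuple t))%:E).
  by have /measurable_EFinP := mw b.
have [p0 q0] : (0 <= p%:E)%E /\ (0 <= (1 - p)%:E)%E.
  by rewrite !lee_fin; split; case/andP: p01; rewrite -/p; lra.
have w0E b t : (0 <= (weighted_likelihood (rcons (history xi n) (z b))
    (col_of_tuple t))%:E)%E.
  by rewrite lee_fin.
rewrite /I /integral_Rd -!ge0_integralZl//.
rewrite -ge0_integralD//; last 4 first.
  by move=> t _; rewrite mule_ge0.
  by apply: emeasurable_funM => //; exact: measurable_cst.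
  by move=> t _; rewrite mule_ge0.
  by apply: emeasurable_funM => //; exact: measurable_cst.
apply: eq_integral => t _; rewrite -!EFinM -EFinD; congr EFin.
rewrite !weighted_likelihood_rcons (mulrA p) (mulrA (1 - p)) -mulrDl.
by rewrite [X in X * _]likelihood_ratio_mean// mul1r.
Qed.

(** The residual is 1 - p or - p, so the stake is the difference of the two
    capitals that the round can lead to. *)
Definition bayesian_strategy : strategy R d := fun h p c =>
  fine (integral_Rd (weighted_likelihood (rcons h (p, c, true)))) -
  fine (integral_Rd (weighted_likelihood (rcons h (p, c, false)))).

Lemma bayesian_capitalE xi n :
  bayesian_capital pi xi n = integral_Rd (weighted_likelihood (history xi n)).
Proof.
congr (integral_Rd _); apply/funext => theta.
by rewrite weighted_likelihood_history.
Qed.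

Lemma bayesian_strategyP : bayesian_logistic pi bayesian_strategy.
Proof.
move=> xi n; rewrite bayesian_capitalE; elim: n => [|n IHn].
  case: pi_prior => _ _ <-; congr (integral_Rd _); apply/funext => theta.
  by rewrite /weighted_likelihood /history big_nil mul1r.
have := bayesian_fair xi n; cbv zeta; rewrite -IHn historyS /=.
rewrite /bayesian_strategy.
have I0 b : (0 <= integral_Rd (weighted_likelihood
    (rcons (history xi n) (prob xi n, side xi n, b))))%E.
  apply: integral_ge0 => t _.
  rewrite lee_fin weighted_likelihood_rcons mulr_ge0//.
    exact/likelihood_ratio_ge0/prob_itv.
  exact: weighted_likelihood_ge0.
move: (I0 true) (I0 false).
have /andP[p0 p1] := prob_itv xi n.
have q0 : 0 < 1 - prob xi n by lra.
set I1 := integral_Rd _; set I2 := integral_Rd _.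
have -> : integral_Rd (weighted_likelihood (rcons (history xi n)
    (prob xi n, side xi n, outcome xi n))) = if outcome xi n then I1 else I2.
  by case: (outcome xi n).
rewrite /residual.
case: I1 I2 => [a| |] [b| |] // _ _; rewrite ?gt0_muley ?lte_fin//.
move=> [ab]; rewrite -ab /=; case: (outcome xi n); congr EFin => /=; ring.
Qed.

End bayesian_martingale.

(** * Laplace's lower bound for the mixture *)

Section mixture_lower_bound.
Variables (R : realType) (d : nat) (pi : 'cV[R]_d -> R).
Hypothesis pi_prior : prior_density pi.

(** Laplace's lower bound on a single day.  The parameter A replaces the
    statistic Q >= A, so that the bound and the smallness of theta0 depend on
    V_n only. *)
Lemma bayesian_capital_ge (delta rho M e A u r : R) xi n :
  0 <= delta -> 0 < e ->
  (forall theta : 'cV[R]_d, (forall i, `|theta i 0| <= rho) ->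
    delta <= pi theta) ->
  (forall i j, `|side xi i j 0| <= M) ->
  d%:R * (rho * M) <= e / (1 + e) ->
  let V := V_ xi n in let S := S_ xi n in
  0 < lambda_min V -> lambda_max V <= u -> 0 < u ->
  0 < A -> A <= dot S (invmx V *m S) ->
  A <= lambda_min V * (rho / 2) ^+ 2 ->
  0 <= r -> r <= rho / 2 -> u * (d%:R * r ^+ 2) <= 1 ->
  ((delta * expR ((1 - e) / 2 * A - (1 + e) / 2) * r ^+ d)%:E <=
   bayesian_capital pi xi n)%E.
Proof.
move=> delta0 e0 pi_ge side_le small V S l0 Vu u0 A0 AQ Al r0 r_rho ur.
have symV : V^T = V := V_sym xi n.
have V_unit : V \in unitmx.
  rewrite unitmxE unitfE gt_eqF// (lt_le_trans (exprn_gt0 d l0))//.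
  by have /andP[] := det_bounds symV (ltW l0).
set Q := dot S (invmx V *m S) in AQ.
have Q0 : 0 < Q by exact: lt_le_trans AQ.
pose t := Num.sqrt (A / Q).
have t0 : 0 <= t by exact: sqrtr_ge0.
have t2 : t ^+ 2 * Q = A.
  by rewrite sqr_sqrtr ?divrK ?unitfE ?gt_eqF// divr_ge0// ltW.
have tQ : A <= t * Q.
  rewrite -t2 expr2 -mulrA ler_piMl ?(mulr_ge0 t0 (ltW Q0))//.
  by rewrite -sqrtr1 ler_wsqrtr// ler_pdivrMr// mul1r.
pose theta0 := t *: (invmx V *m S).
have Vtheta0 : V *m theta0 = t *: S.
  by rewrite -scalemxAr mulmxA mulmxV// mul1mx.
have theta0S : dot theta0 S = t * Q by rewrite dotZl dotC.
have theta0V : dot theta0 (V *m theta0) = A.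
  by rewrite Vtheta0 dotZr theta0S mulrA -expr2.
have rho0 : 0 <= rho by lra.
have theta0_le i : `|theta0 i 0| <= rho / 2.
  rewrite -(ler_pXn2r (n := 2)) ?nnegrE ?normr_ge0// ?divr_ge0//.
  rewrite real_normK ?num_real// -(ler_pM2l l0).
  apply: le_trans Al; rewrite -theta0V.
  have /andP[+ _] := rayleigh_bounds theta0 symV; apply: le_trans.
  by rewrite ler_wpM2l ?(ltW l0)// sqr_entry_le_dot.
clearbody theta0.
(* k is the coefficient of the linear term at theta0; the box lies on the side
   of theta0 where k * dot phi S is a sum of non-negative terms. *)
pose k := 1 - (1 + e) * t.
pose a i := theta0 i 0 - (if 0 <= k * S i 0 then 0 else r).
rewrite /bayesian_capital; apply: (integral_Rd_ge_box (a := a)) => //.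
- have := measurable_weighted_likelihood pi_prior xi n.
  congr (measurable_fun _ (_ \o _)).
  by apply/funext => theta; rewrite weighted_likelihood_history.
- move=> theta; rewrite -weighted_likelihood_history.
  exact: weighted_likelihood_ge0.
- by rewrite mulr_ge0// expR_ge0.
move=> theta box; pose phi := theta - theta0.
have phi_le i : `|phi i 0| <= r.
  have := box i; rewrite /phi /a !mxE ler_norml.
  by case: ifP => _; lra.
have kphi : 0 <= k * dot phi S.
  rewrite dotE mulr_sumr sumr_ge0// => i _; rewrite mulrCA.
  have := box i; rewrite /phi /a !mxE.
  case: ifPn => [kS|]; first by move=> ?; apply: mulr_ge0 => //; lra.
  by rewrite -ltNge => kS ?; apply: mulr_le0; lra.
have phiV : dot phi (V *m phi) <= 1.
  have /andP[_ h] := rayleigh_bounds phi symV.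
  apply: le_trans ur; apply: (le_trans h).
  apply: (@le_trans _ _ (u * dot phi phi)).
    by rewrite ler_wpM2r// dot_ge0.
  rewrite ler_wpM2l ?(ltW u0)// (le_trans (ler_norm _))// expr2.
  exact: norm_dot_le.
have theta_le i : `|theta i 0| <= rho.
  have -> : theta i 0 = theta0 i 0 + phi i 0 by rewrite /phi !mxE; ring.
  rewrite (le_trans (ler_normD _ _))//.
  by have := theta0_le i; have := phi_le i; lra.
rewrite mulrC ler_pM ?expR_ge0//; last exact: pi_ge.
apply: le_trans (logistic_capital_ge _ e0 _); last first.
  by move=> i; apply: le_trans small; exact: norm_dot_le.
have thetaE : theta = theta0 + phi by rewrite /phi addrC subrK.
rewrite ler_expR thetaE.
rewrite (quadratic_exponent_shift phi (1 + e) symV Vtheta0 theta0V) -/k theta0S.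
have : (1 + e) / 2 * dot phi (V *m phi) <= (1 + e) / 2.
  by rewrite ler_piMr//; lra.
rewrite -/S; lra.
Qed.

End mixture_lower_bound.

(** * Limits superior *)

Section limsup.
Variable R : realType.
Implicit Type u : (\bar R)^nat.

Lemma limn_esup_inf u : limn_esup u = ereal_inf (range (esups u)).
Proof. by rewrite limn_esup_lim; exact/cvg_lim/cvg_esups_inf. Qed.

Lemma lt_limn_esup u a : (a < limn_esup u)%E ->
  forall N, exists2 n, (N <= n)%N & (a < u n)%E.
Proof.
rewrite limn_esup_inf => au N.
have : (a < esups u N)%E.
  by apply: (lt_le_trans au); apply: ereal_inf_lbound; exists N.
by move=> /ereal_sup_gt[_ [n /= Nn <-] aun]; exists n.
Qed.

Lemma limn_esup_lt_pinfty u : (limn_esup u < +oo)%E ->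
  exists K : R, exists N, forall n, (N <= n)%N -> (u n <= K%:E)%E.
Proof.
rewrite limn_esup_inf => /ereal_inf_lt[_ [N _ <-] uN].
have [K uK] : exists K : R, (esups u N <= K%:E)%E.
  case: (esups u N) uN => [r _| |_]; [by exists r | by rewrite ltxx |].
  by exists 0; rewrite leNye.
exists K, N => n Nn; apply: le_trans uK; apply: ereal_sup_ubound.
by exists n.
Qed.

Lemma limn_esup_pinfty u :
  (forall (B : R) N, exists2 n, (N <= n)%N & (B%:E <= u n)%E) ->
  limn_esup u = +oo%E.
Proof.
move=> unbounded; rewrite limn_esup_inf; apply: eq_infty => B.
apply/ereal_infP => _ [N _ <-]; have [n Nn Bn] := unbounded B N.
by apply: (le_trans Bn); apply: ereal_sup_ubound; exists n.
Qed.

End limsup.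

(** * Growth along regular paths *)

Section growth.
Variable R : realType.

(** The bound of [bayesian_capital_ge] in terms of x = lambda_min alone.  The
    point theta0 tends to 0 since log det V is O(log x), and the capital
    diverges since the loss d log (d w) from the volume of the box is covered
    by log det V >= d log x = 2 d log w - d log kappa, with w^2 = kappa x. *)
Lemma mixture_growth (d : nat) (kappa eta delta rho B : R) :
  (0 < d)%N -> 1 <= kappa -> 0 < eta -> 0 < delta -> 0 < rho ->
  let e := eta / (2 * (1 + eta)) in
  exists2 x0 : R, 0 < x0 & forall x D : R, x0 <= x ->
    x ^+ d <= D -> D <= (kappa * x) ^+ d ->
    let r := (d%:R * Num.sqrt (kappa * x))^-1 in let A := (1 + eta) * ln D in
    [/\ 0 < ln D, A <= x * (rho / 2) ^+ 2,
        0 <= r <= rho / 2 & kappa * x * (d%:R * r ^+ 2) <= 1 /\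
        B <= delta * expR ((1 - e) / 2 * A - (1 + e) / 2) * r ^+ d].
Proof.
move=> d0 k1 eta0 delta0 rho0 e.
have dR1 : 1 <= d%:R :> R by rewrite ler1n.
have dR0 : 0 < d%:R :> R by rewrite ltr0n.
have k0 : 0 < kappa by lra.
(* c1 makes theta0 small (by log w < w), c2 the side of the box, and c3 makes
   the capital exceed B. *)
pose C := (1 + eta / 2) / 2 * d%:R * ln kappa + (1 + e) / 2 + d%:R * ln d%:R.
pose c1 := 8 * kappa * (1 + eta) * d%:R / rho ^+ 2.
pose c2 := 2 / rho.
pose c3 := expR ((B / delta + C) * 2 / (eta * d%:R)).
have c1_ge0 : 0 <= c1 by rewrite divr_ge0 ?exprn_ge0 ?mulr_ge0//; lra.
have c2_ge0 : 0 <= c2 by rewrite divr_ge0//; lra.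
have c3_ge0 : 0 <= c3 by exact: expR_ge0.
exists (2 + (c1 + c2 + c3) ^+ 2) => [|x D x0x xD Dx r A].
  by have := sqr_ge0 (c1 + c2 + c3); lra.
have x1 : 1 < x by have := sqr_ge0 (c1 + c2 + c3); lra.
have x0 : 0 < x by lra.
have kx0 : 0 < kappa * x by exact: mulr_gt0.
rewrite /r; set w := Num.sqrt (kappa * x).
have w2 : w ^+ 2 = kappa * x by rewrite sqr_sqrtr// ltW.
have w0 : 0 < w by rewrite sqrtr_gt0.
have wc : c1 + c2 + c3 <= w.
  have c_ge0 : 0 <= c1 + c2 + c3 by lra.
  rewrite -(ler_pXn2r (n := 2)) ?nnegrE ?(ltW w0)// w2.
  by rewrite (@le_trans _ _ x)//; [lra | rewrite ler_peMl// ltW].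
have wc1 : c1 <= w by lra.
have wc2 : c2 <= w by lra.
have wc3 : c3 <= w by lra.
have D0 : 0 < D by apply: lt_le_trans xD; exact: exprn_gt0.
have lnD_ge : d%:R * ln x <= ln D.
  by rewrite -ler_expR expRM_natl !lnK// posrE.
have lnkx : ln (kappa * x) = 2 * ln w.
  by rewrite -w2 lnXn// mulr_natl.
have lnD_le : ln D <= d%:R * (2 * w).
  apply: (@le_trans _ _ (d%:R * ln (kappa * x))).
    by rewrite -ler_expR expRM_natl !lnK// posrE.
  rewrite ler_wpM2l// ?(ltW dR0)// lnkx ler_wpM2l//.
  exact/ltW/ln_sublinear.
have lnx : ln x = 2 * ln w - ln kappa.
  by rewrite -lnkx lnM ?posrE// addrAC subrr add0r.
have lnD0 : 0 < ln D by apply: lt_le_trans lnD_ge; rewrite mulr_gt0// ln_gt0.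
have dw0 : 0 < d%:R * w by exact: mulr_gt0.
split => //.
- apply: (@le_trans _ _ ((1 + eta) * (d%:R * (2 * w)))).
    by rewrite ler_wpM2l//; lra.
  have -> : x = w ^+ 2 / kappa by rewrite w2 mulrAC mulfV ?mul1r// gt_eqF.
  have -> : (1 + eta) * (d%:R * (2 * w)) = c1 * w * ((rho / 2) ^+ 2 / kappa).
    by rewrite /c1; field; rewrite !gt_eqF.
  have -> : w ^+ 2 / kappa * (rho / 2) ^+ 2 = w * w * ((rho / 2) ^+ 2 / kappa).
    by field; rewrite gt_eqF.
  rewrite ler_wpM2r ?divr_ge0 ?sqr_ge0 ?(ltW k0)//.
  by rewrite ler_wpM2r// ltW.
- rewrite invr_ge0 (ltW dw0)/= -[rho / 2]invrK invf_div lef_pV2 ?posrE//.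
    by rewrite (le_trans wc2)// ler_peMl// ltW.
  by rewrite divr_gt0.
- split.
    have -> : kappa * x * (d%:R * (d%:R * w)^-1 ^+ 2) = d%:R^-1.
      by rewrite -w2; field; rewrite !gt_eqF.
    by rewrite invf_le1.
  have rE : (d%:R * w)^-1 ^+ d = expR (- (d%:R * (ln d%:R + ln w))).
    rewrite expRN expRM_natl expRD !lnK ?posrE// exprVn//.
  rewrite rE -mulrA -expRD mulrC -ler_pdivrMr//.
  apply: (@le_trans _ _ (eta / 2 * d%:R * ln w - C)).
    have : (B / delta + C) * 2 / (eta * d%:R) <= ln w.
      by rewrite -ler_expR lnK// posrE.
    rewrite ler_pdivrMr ?mulr_gt0//; lra.
  apply: le_trans (expR_ge1Dx _); rewrite -[X in X <= _]add0r.
  apply: lerD => //.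
  have -> : (1 - e) / 2 * A = (1 + eta / 2) / 2 * ln D.
    by rewrite /A /e; field; lra.
  have : (1 + eta / 2) / 2 * (d%:R * ln x) <= (1 + eta / 2) / 2 * ln D.
    by rewrite ler_wpM2l//; lra.
  rewrite lnx /C; lra.
Qed.

End growth.

(** * Forcing *)

Section forcing.
Variables (R : realType) (d : nat).

Lemma supports_nbhs_originP (pi : 'cV[R]_d -> R) : supports_nbhs_origin pi ->
  exists delta rho : R, [/\ 0 < delta, 0 < rho &
    forall theta : 'cV[R]_d, (forall i, `|theta i 0| <= rho) ->
      delta <= pi theta].
Proof.
case=> delta delta0 /nbhs_ballP[r /= r0 pi_r]; exists delta, (r / 2).
split=> //; first by rewrite divr_gt0.
move=> theta theta_r; apply: pi_r; split=> // i j.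
rewrite /ball/= mxE sub0r normrN ord1 (le_lt_trans (theta_r i))//.
lra.
Qed.

Lemma bounded_side (xi : game_path R d) : bounded_set (range (side xi)) ->
  exists2 M : R, 0 < M & forall i j, `|side xi i j 0| <= M.
Proof.
move=> [M [_ bM]]; have M1 : M < `|M| + 1 by have := ler_norm M; lra.
exists (`|M| + 1) => [|i j]; first by have := normr_ge0 M; lra.
apply: le_trans (bM _ M1 _ _); last by exists i.
rewrite [in X in _ <= X]/Num.Def.normr/= mx_normrE.
exact: (le_bigmax _ (fun ij => `|side xi i ij.1 ij.2|) (j, 0)).
Qed.

(** A day on which the ratio exceeds 1 + eta provides the hypothesis A <= Q of
    [bayesian_capital_ge]; there are such days beyond every bound, and
    [mixture_growth] applies on all late ones. *)
Lemma bayesian_capital_unbounded (pi : 'cV[R]_d -> R) (xi : game_path R d) :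
  (0 < d)%N -> prior_density pi -> supports_nbhs_origin pi ->
  regularity_event xi -> ~ lil_bound xi ->
  limn_esup (bayesian_capital pi xi) = +oo%E.
Proof.
move=> d0 pi_prior /supports_nbhs_originP[delta [rho' [delta0 rho'0 pi_ge]]].
move=> [/cvgryPge lminy /limn_esup_lt_pinfty[K [N1 ratioK]]].
move=> /bounded_side[M M0 side_le] /negP; rewrite -ltNge => lil_gt.
have [eta eta0 lil_eta] : exists2 eta : R, 0 < eta &
    ((1 + eta)%:E < limn_esup (fun n => (lil_ratio xi n)%:E))%E.
  case: (limn_esup _) lil_gt => [L| |] //.
    by rewrite lte_fin => L1; exists ((L - 1) / 2); rewrite ?lte_fin; lra.
  by move=> _; exists 1 => //; rewrite ltry.
have dR0 : 0 < d%:R :> R by rewrite ltr0n.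
pose e := eta / (2 * (1 + eta)).
have e0 : 0 < e by rewrite /e divr_gt0//; lra.
pose rho := Num.min rho' (e / (1 + e) / (d%:R * M)).
have rho0 : 0 < rho.
  rewrite /rho lt_min rho'0/=; apply: divr_gt0; last exact: mulr_gt0.
  by apply: divr_gt0 => //; lra.
have small : d%:R * (rho * M) <= e / (1 + e).
  rewrite mulrCA -ler_pdivlMr ?mulr_gt0//.
  by rewrite /rho ge_min lexx orbT.
pose kappa := Num.max 1 K.
apply: limn_esup_pinfty => B N.
have k1 : 1 <= kappa by rewrite le_max lexx.
have [x0 x0_gt0 growth] := mixture_growth B d0 k1 eta0 delta0 rho0.
have [N2 _ lmin_ge] := lminy x0.
have [n] := lt_limn_esup lil_eta (maxn N (maxn N1 N2)).
rewrite !geq_max => /and3P[Nn N1n N2n]; rewrite lte_fin => lil_n.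
exists n => //; set V := V_ xi n.
have symV : V^T = V := V_sym xi n.
have l_ge : x0 <= lambda_min V := lmin_ge n N2n.
have l0 : 0 < lambda_min V by exact: lt_le_trans l_ge.
have lambda_max_le : lambda_max V <= kappa * lambda_min V.
  rewrite -ler_pdivrMr// le_max; apply/orP; right.
  by rewrite -lee_fin; exact: ratioK.
have [detl detu] := andP (det_bounds symV (ltW l0)).
have {}detu : \det V <= (kappa * lambda_min V) ^+ d.
  apply: (le_trans detu); rewrite lerXn2r// nnegrE.
    exact: le_trans (ltW l0) (lambda_min_le_max d0 symV).
  by rewrite mulr_ge0 ?(ltW l0)//; lra.
have := growth _ _ l_ge detl detu; cbv zeta; rewrite -/e.
set r := (_ * Num.sqrt _)^-1; set A := _ * ln _.
move=> [lnD0 A_le /andP[r0 r_le] [kr B_le]].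
apply: (@le_trans _ _
  (delta * expR ((1 - e) / 2 * A - (1 + e) / 2) * r ^+ d)%:E).
  by rewrite lee_fin.
apply: (bayesian_capital_ge pi_prior (M := M) (rho := rho)
  (u := kappa * lambda_min V)) => //.
- exact: ltW.
- move=> theta theta_le; apply: pi_ge => i; rewrite (le_trans (theta_le i))//.
  by rewrite ge_min lexx.
- by apply: mulr_gt0 => //; lra.
- by rewrite /A mulr_gt0//; lra.
- by rewrite -ler_pdivlMr//; exact: ltW.
Qed.

End forcing.

Theorem theorem4p2 (R : realType) (d : nat) (hd : (0 < d)%N)
    (pi : 'cV[R]_d -> R) (hpi : prior_density pi)
    (hsupp : supports_nbhs_origin pi) :
  (exists sigma : strategy R d, bayesian_logistic pi sigma) /\
  (forall sigma : strategy R d, bayesian_logistic pi sigma ->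
    weakly_forces sigma (@regularity_event R d) (@lil_bound R d)).
Proof.
split; first by exists (bayesian_strategy pi); exact: bayesian_strategyP.
move=> sigma sigmaE; split=> [xi n|xi regular not_lil].
  rewrite -lee_fin sigmaE bayesian_capitalE; apply: integral_ge0 => t _.
  by rewrite lee_fin; exact: weighted_likelihood_ge0.
rewrite (_ : (fun n => _) = bayesian_capital pi xi).
  exact: bayesian_capital_unbounded.
by apply/funext => n; exact: sigmaE.
Qed.
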